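(* Let a Fučík system $F_{\alpha,\beta}=\{f^n_{\alpha(n),\beta(n)}\}_{n\in\mathbb{N}_0}$ for the Neumann Laplacian on $(0,\pi)$ be a Riesz basis in $L^2(0,\pi)$, and write $f^n_{\alpha,\beta}:=f^n_{\alpha(n),\beta(n)}$. Let $\phi_0\equiv\frac{\sqrt2}{2}$. Then the first element $\psi_0$ of the corresponding biorthogonal system $\{\psi_m\}_{m\in\mathbb{N}_0}$ can be characterized through the following weak convergence in $L^2(0,\pi)$: $$\phi_0-\sum_{n=1}^k\langle f^n_{\alpha,\beta},\phi_0\rangle\psi_n\rightharpoonup\psi_0\quad\text{as } k\to\infty.$$ Moreover, we have $$\psi_0=\phi_0-\sum_{n=1}^\infty\langle f^n_{\alpha,\beta},\phi_0\rangle\psi_n$$ in the sense of the strong convergence in $L^2(0,\pi)$ if and only if $\sum_{n=1}^\infty\langle f^n_{\alpha,\beta},\phi_0\rangle^2<\infty$.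
   Context: $L^2(0,\pi)$ is the real Hilbert space with standard scalar product $\langle u,v\rangle=\int_0^\pi uv\,dx$ and norm $\|\cdot\|$; $\mathbb{N}=\{1,2,\dots\}$, $\mathbb{N}_0=\mathbb{N}\cup\{0\}$. For $n\in\mathbb{N}$ let $\Gamma_n=\{(\alpha,\beta)\in\mathbb{R}^2: \alpha,\beta>0,\ \frac n2\frac{\pi}{\sqrt\alpha}+\frac n2\frac{\pi}{\sqrt\beta}=\pi\}$. For $(\alpha,\beta)\in\Gamma_n$, the normalized Fučík eigenfunction $f^n_{\alpha,\beta}$ is the $C^2$-solution of $-u''=\alpha u^+-\beta u^-$ in $(0,\pi)$, $u'(0)=u'(\pi)=0$ (where $u^\pm=\max\{\pm u,0\}$) with $f^n_{\alpha,\beta}(0)>0$ and $\sup_{[0,\pi]}|f^n_{\alpha,\beta}|=1$. Explicitly, with $l_1=\pi/\sqrt\alpha$, $l_2=\pi/\sqrt\beta$, $l=l_1+l_2=2\pi/n$, $k\in\mathbb{Z}$: if $\alpha\ge n^2\ge\beta$, then $f^n_{\alpha,\beta}(x)=\frac{\sqrt\beta}{\sqrt\alpha}\cos(\sqrt\alpha(x-kl))$ for $kl-\frac{l_1}{2}\le x<kl+\frac{l_1}{2}$ and $f^n_{\alpha,\beta}(x)=-\cos(\sqrt\beta(x-\frac{2k+1}{2}l))$ for $\frac{2k+1}{2}l-\frac{l_2}{2}\le x<\frac{2k+1}{2}l+\frac{l_2}{2}$; if $\beta>n^2>\alpha$, then on the same intervals $f^n_{\alpha,\beta}(x)=\cos(\sqrt\alpha(x-kl))$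 and $f^n_{\alpha,\beta}(x)=-\frac{\sqrt\alpha}{\sqrt\beta}\cos(\sqrt\beta(x-\frac{2k+1}{2}l))$, respectively. For $n=0$ set $f^0_{\alpha,\beta}=\phi_0\equiv\frac{\sqrt2}{2}$. A Fučík system is a sequence $F_{\alpha,\beta}=\{f^n_{\alpha(n),\beta(n)}\}_{n\in\mathbb{N}_0}$ where $\alpha,\beta:\mathbb{N}_0\to\mathbb{R}$ satisfy $\alpha(0)=\beta(0)=0$ and $(\alpha(n),\beta(n))\in\Gamma_n$ for every $n\ge1$. A sequence in a Hilbert space $H$ is a Riesz basis in $H$ if it is the image of a complete orthonormal system of $H$ under some linear homeomorphism of $H$. The biorthogonal system of a Riesz basis $F_{\alpha,\beta}$ is the unique sequence $\{\psi_m\}_{m\in\mathbb{N}_0}\subset L^2(0,\pi)$ with $\langle f^n_{\alpha(n),\beta(n)},\psi_m\rangle=\delta_{n,m}$ (Kronecker delta) for all $m,n\in\mathbb{N}_0$.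
   Formalization: The limit and the left-hand side of the series identity are ⟨φ_0,φ_0⟩ψ_0 = (π/2)ψ_0 instead of ψ_0, because φ_0 = √2/2 is not a unit vector for the standard scalar product and the formula as printed fails, e.g. for f^n = cos(nx). *)

(* Defs.v *)
From HB Require Import structures.
From mathcomp Require Import all_boot all_order all_algebra.
From mathcomp Require Import all_classical all_reals all_analysis.

Set Implicit Arguments.
Unset Strict Implicit.
Unset Printing Implicit Defensive.

Import Order.TTheory GRing.Theory Num.Theory.
Import numFieldNormedType.Exports.

Local Open Scope classical_set_scope.
Local Open Scope ring_scope.

Definition mu0pi (R : realType) : {measure set (measurableTypeR R) -> \bar R} :=
  mrestr (@lebesgue_measure R) (measurable_itv `]0, pi[).

(* Square-integrable functions, as an R-module of representatives: two elements
   denote the same vector of L^2(0, pi) iff they are equal mu0pi-a.e., so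
   equality of vectors is always written [u = v %[ae mu0pi R]] below. *)
Notation L2 R := (LfunType (mu0pi R) (lee1n 2)).

Section HilbertNotions.
Context {R : realType}.
Implicit Types (u v : L2 R) (e F psi : nat -> L2 R) (T : L2 R -> L2 R).

Definition inner u v : R := (\int[mu0pi R]_x (u x * v x))%R.

Definition L2norm u : R := Num.sqrt (inner u u).

Definition weak_cvg (s : nat -> L2 R) (l : L2 R) : Prop :=
  forall v, inner (s k) v @[k --> \oo] --> inner l v.

Definition strong_cvg (s : nat -> L2 R) (l : L2 R) : Prop :=
  L2norm (s k - l) @[k --> \oo] --> (0 : R).

Definition orthonormal_seq e : Prop :=
  forall i j, inner (e i) (e j) = (i == j)%:R.

Definition complete_seq e : Prop :=
  forall u (eps : R), 0 < eps -> exists n (c : nat -> R),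
    L2norm (u - \sum_(i < n) c i *: e i) < eps.

Definition L2_linear T : Prop :=
  forall (a : R) u v, T (a *: u + v) = a *: T u + T v %[ae mu0pi R].

(* Continuity for the L^2 norm; it implies that T is compatible with equality
   a.e., i.e. that it is a map on L^2(0, pi). *)
Definition L2_continuous T : Prop :=
  forall u (eps : R), 0 < eps -> exists2 delta : R, 0 < delta &
    forall v, L2norm (v - u) < delta -> L2norm (T v - T u) < eps.

Definition linear_homeomorphism T : Prop :=
  exists S : L2 R -> L2 R,
    [/\ L2_linear T, L2_continuous T, L2_continuous S,
        forall u, S (T u) = u %[ae mu0pi R] &
        forall u, T (S u) = u %[ae mu0pi R]].

Definition riesz_basis F : Prop :=
  exists e T, [/\ orthonormal_seq e, complete_seq e, linear_homeomorphism T &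
    forall n, F n = T (e n) %[ae mu0pi R]].

Definition biorthogonal F psi : Prop :=
  forall m n, inner (F n) (psi m) = (n == m)%:R.

End HilbertNotions.

Section Fucik.
Context {R : realType}.

Definition Gamma (n : nat) (a b : R) : Prop :=
  [/\ 0 < a, 0 < b &
      n%:R / 2 * (pi / Num.sqrt a) + n%:R / 2 * (pi / Num.sqrt b) = pi].

(* The Neumann conditions are expressed as one-sided limits of u'. For u
   continuous on [0, pi] this is the same as u being C^1 up to the boundary with
   vanishing one-sided derivatives; u is then C^2 up to the boundary by the
   equation. For (a, b) in Gamma n this determines u on [0, pi]. *)
Definition normalized_fucik_eigenfunction (a b : R) (u : R -> R) : Prop :=
  [/\ {within `[0, pi], continuous u},
      forall x, x \in `]0, pi[ ->
        [/\ derivable u x 1, derivable (derive1 u) x 1 & {for x, continuous (derive1n 2 u)}],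
      forall x, x \in `]0, pi[ -> - derive1n 2 u x = a * u^\+ x - b * u^\- x,
      derive1 u x @[x --> 0^'+] --> (0 : R) /\ derive1 u x @[x --> pi^'-] --> (0 : R) &
      0 < u 0 /\ sup [set `|u x| | x in `[0, pi]] = 1].

Lemma phi0_Lfun :
  (cst (Num.sqrt 2 / 2) : measurableTypeR R -> R) \in Lfun (mu0pi R) 2%:E.
Proof.
rewrite inE; apply/andP; split; rewrite inE /=; first exact: measurable_cst.
rewrite /finite_norm unlock poweR_lty//.
set c := (Num.sqrt 2 / 2).
rewrite (_ : (\int[mu0pi R]_x _)%E = (\int[mu0pi R]_x cst ((`|c| `^ 2)%:E) x)%E)//.
rewrite integral_cst//= /mrestr setTI lebesgue_measure_itv /= lte_fin pi_gt0.
by rewrite oppr0 adde0 -EFinM ltry.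
Qed.

Definition phi0 : L2 R := Lfun_Sub (lee1n 2) phi0_Lfun.

(* phi0 is not a unit vector: the quantity [inner phi0 phi0] matters whenever
   phi0 is paired with a system biorthogonal to one containing phi0. *)
Lemma inner_phi0 : inner phi0 phi0 = pi / 2.
Proof.
rewrite /inner /Rintegral /=.
set c := (Num.sqrt 2 / 2).
rewrite (_ : (\int[mu0pi R]_x _)%E = (\int[mu0pi R]_x cst ((c * c)%:E) x)%E)//.
rewrite integral_cst//= /mrestr setTI lebesgue_measure_itv /= lte_fin pi_gt0.
rewrite oppr0 adde0 -EFinM /= /c mulrACA -expr2 sqr_sqrtr ?ler0n//.
by rewrite mulrA mulfV ?pnatr_eq0// mul1r mulrC.
Qed.

Definition fucik_system (alpha beta : nat -> R) (F : nat -> L2 R) : Prop :=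
  [/\ alpha 0%N = 0 /\ beta 0%N = 0,
      forall n, (1 <= n)%N -> Gamma n (alpha n) (beta n),
      F 0%N = phi0 %[ae mu0pi R] &
      forall n, (1 <= n)%N -> exists2 u : R -> R,
        normalized_fucik_eigenfunction (alpha n) (beta n) u &
        F n = u %[ae mu0pi R]].

End Fucik.

(* Main.v *)
Require Import Defs.
From mathcomp Require Import all_boot all_order all_algebra.
From mathcomp Require Import all_classical all_reals all_analysis.
From mathcomp Require Import ring lra.

(** A Riesz basis F = T e, with T a homeomorphism and e orthonormal and
    complete, expands every v as the norm-convergent sum of <v, psi_n> F_n, with
    sum <v, psi_n>^2 <= C^2 |v|^2 and |sum c_n F_n|^2 <= C^2 sum c_n^2. Since
    F_0 = phi_0, subtracting the claimed limit <phi_0, phi_0> psi_0 from the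
    k-th approximant leaves d_k = phi_0 - sum_(n <= k) <F_n, phi_0> psi_n; pairing
    d_k with v gives the remainder of the expansion of v paired with phi_0,
    whence the weak convergence. The two bounds make |d_k| -> 0 equivalent to the
    square summability of <F_n, phi_0>. *)

Set Implicit Arguments.
Unset Strict Implicit.
Unset Printing Implicit Defensive.

Import Order.TTheory GRing.Theory Num.Theory.
Import numFieldNormedType.Exports.

Local Open Scope classical_set_scope.
Local Open Scope ring_scope.

(** * The L^2 inner product on representatives, up to Cauchy-Schwarz *)

Section InnerProduct.
Context {R : realType}.
Implicit Types (u v w : L2 R) (a : R).

Lemma integrable_mulL2 u v :
  (mu0pi R).-integrable setT (EFin \o (fun x => u x * v x)).
Proof. by apply/Lfun1_integrable; apply: Lfun2_mul_Lfun1; exact: LfunP. Qed.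

Lemma ae_eq_inner u v w : u = v %[ae mu0pi R] -> inner u w = inner v w.
Proof.
move=> uv; rewrite /inner /Rintegral; congr fine.
apply: ae_eq_integral => //.
- exact: (measurable_int _ (integrable_mulL2 u w)).
- exact: (measurable_int _ (integrable_mulL2 v w)).
- by apply: filterS uv => x uvx Dx /=; rewrite uvx.
Qed.

Lemma innerC u v : inner u v = inner v u.
Proof. by apply: eq_Rintegral => x _; rewrite mulrC. Qed.

Lemma innerDl u v w : inner (u + v) w = inner u w + inner v w.
Proof.
rewrite /inner -RintegralD//; try exact: integrable_mulL2.
by apply: eq_Rintegral => x _; rewrite /= mulrDl.
Qed.

Lemma innerZl a u w : inner (a *: u) w = a * inner u w.
Proof.
rewrite /inner -RintegralZl//; try exact: integrable_mulL2.
by apply: eq_Rintegral => x _; rewrite /= mulrA.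
Qed.

Lemma inner0l w : inner 0 w = 0.
Proof. by rewrite -(scale0r 0) innerZl mul0r. Qed.

Lemma innerBl u v w : inner (u - v) w = inner u w - inner v w.
Proof. by rewrite -scaleN1r innerDl innerZl mulN1r. Qed.

Lemma inner_suml (I : Type) (r : seq I) (P : pred I) (f : I -> L2 R) w :
  inner (\sum_(i <- r | P i) f i) w = \sum_(i <- r | P i) inner (f i) w.
Proof.
by apply: (big_morph (inner^~ w)) => [u v|]; [exact: innerDl|exact: inner0l].
Qed.

Lemma innerZr a u w : inner w (a *: u) = a * inner w u.
Proof. by rewrite innerC innerZl (innerC w). Qed.

Lemma innerBr u v w : inner w (u - v) = inner w u - inner w v.
Proof. by rewrite innerC innerBl !(innerC w). Qed.

Lemma inner_sumr (I : Type) (r : seq I) (P : pred I) (f : I -> L2 R) w :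
  inner w (\sum_(i <- r | P i) f i) = \sum_(i <- r | P i) inner w (f i).
Proof. by rewrite innerC inner_suml; apply: eq_bigr => i _; rewrite innerC. Qed.

Lemma inner_ge0 u : 0 <= inner u u.
Proof. by apply: Rintegral_ge0 => x _; rewrite -expr2 sqr_ge0. Qed.

Lemma sqr_L2norm u : L2norm u ^+ 2 = inner u u.
Proof. by rewrite sqr_sqrtr// inner_ge0. Qed.

Lemma L2norm_ge0 u : 0 <= L2norm u.
Proof. exact: sqrtr_ge0. Qed.

Lemma L2normZ a u : L2norm (a *: u) = `|a| * L2norm u.
Proof.
by rewrite /L2norm innerZl innerZr mulrA -expr2 sqrtrM ?sqr_ge0// sqrtr_sqr.
Qed.

Lemma Cauchy_Schwarz_L2 u v : `|inner u v| <= L2norm u * L2norm v.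
Proof.
rewrite -[leLHS]ger0_norm// -[leRHS]ger0_norm ?mulr_ge0 ?L2norm_ge0//.
rewrite -ler_sqr ?nnegrE// !real_normK ?num_real// exprMn !sqr_L2norm.
have quad t : 0 <= inner u u - 2 * t * inner u v + t ^+ 2 * inner v v.
  have := inner_ge0 (u - t *: v).
  by rewrite !(innerBl, innerBr, innerZl, innerZr) (innerC v u); lra.
(* Here [quad] is affine in [t]; if [inner u v] were nonzero, the chosen [t] would give it the value
   -1. *)
have [v0|v0] := eqVneq (inner v v) 0.
  have [->|uv0] := eqVneq (inner u v) 0; first by rewrite v0 expr0n mulr0.
  have := quad ((inner u u + 1) / (2 * inner u v)).
  rewrite v0 mulr0 addr0.
  have -> : 2 * ((inner u u + 1) / (2 * inner u v)) * inner u v = inner u u + 1.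
    by field.
  lra.
have v_gt0 : 0 < inner v v by rewrite lt_def v0 inner_ge0.
have := quad (inner u v / inner v v).
have -> : inner u u - 2 * (inner u v / inner v v) * inner u v +
    (inner u v / inner v v) ^+ 2 * inner v v =
    (inner u u * inner v v - inner u v ^+ 2) / inner v v by field.
by rewrite pmulr_lge0 ?invr_gt0// subr_ge0.
Qed.

Lemma L2norm0_inner u w : L2norm u = 0 -> inner u w = 0.
Proof.
move=> u0; apply/eqP; rewrite -normr_le0.
by have := Cauchy_Schwarz_L2 u w; rewrite u0 mul0r.
Qed.

(** From here on [inner u =1 inner v] stands for equality of vectors: representatives of one vector
    need not be equal as terms. *)
Lemma L2norm_eq u v : inner u =1 inner v -> L2norm u = L2norm v.
Proof. by move=> uv; rewrite /L2norm uv innerC uv. Qed.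

End InnerProduct.

(** * Bounded operators and Riesz bases *)

Section RieszBasis.
Context {R : realType}.
Implicit Types (u v w : L2 R) (e F psi : nat -> L2 R) (T S : L2 R -> L2 R).

(** Linearity of [T] holds only almost everywhere; pairing with [w] turns it into an equation one
    can rewrite with. *)
Lemma L2_linear_inner T (a : R) u v w : L2_linear T ->
  inner (T (a *: u + v)) w = a * inner (T u) w + inner (T v) w.
Proof. by move=> linT; rewrite (ae_eq_inner _ (linT a u v)) innerDl innerZl. Qed.

Lemma L2_linear0 T w : L2_linear T -> inner (T 0) w = 0.
Proof.
move=> linT; have := L2_linear_inner 1 0 0 w linT.
by rewrite scale1r addr0 mul1r => /eqP; rewrite -subr_eq0 opprD addNKr oppr_eq0 => /eqP.
Qed.

Lemma L2_linear_sum T n (c : nat -> R) e w : L2_linear T ->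
  inner (T (\sum_(i < n) c i *: e i)) w = \sum_(i < n) c i * inner (T (e i)) w.
Proof.
move=> linT; elim: n => [|n IHn]; first by rewrite !big_ord0 L2_linear0.
by rewrite !big_ord_recr/= addrC L2_linear_inner// IHn addrC.
Qed.

(** The difference [u - v] has norm 0, below every [delta], so the images are closer than every
    [eps]. *)
Lemma L2_continuous_inner T u v : L2_continuous T ->
  inner u =1 inner v -> inner (T u) =1 inner (T v).
Proof.
move=> cT uv w; apply/eqP; rewrite -subr_eq0 -innerBl; apply/eqP.
apply: L2norm0_inner; apply/eqP; rewrite eq_le L2norm_ge0 andbT.
apply/ler_addgt0Pl => eps eps0; rewrite addr0 ltW//.
have [d d0] := cT v _ eps0; apply.
rewrite (@L2norm_eq _ _ 0) => [|z]; last by rewrite innerBl uv subrr inner0l.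
by rewrite /L2norm inner0l sqrtr0.
Qed.

Lemma L2_bounded T : L2_continuous T ->
    (forall a u, inner (T (a *: u)) =1 inner (a *: T u)) ->
  exists2 C, 0 < C & forall u, L2norm (T u) <= C * L2norm u.
Proof.
move=> cT homT; have [d d0 Td] := cT 0 _ ltr01.
exists d^-1 => [|u]; first by rewrite invr_gt0.
have T0 : inner (T 0) =1 (fun=> 0).
  by move=> w; rewrite -(scale0r 0) homT innerZl mul0r.
apply/ler_addgt0Pl => eps eps0.
(* Scaling [u] by [d / t] brings it into the ball of radius [d]. Dividing by a [t] strictly above
   the norm also covers vectors of norm 0. *)
have [t t0 tE] : exists2 t, L2norm u < t & t / d = eps + d^-1 * L2norm u.
  exists (eps * d + L2norm u); first by rewrite ltrDr mulr_gt0.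
  by rewrite mulrDl mulfK ?gt_eqF// (mulrC (L2norm u)).
have tgt0 : 0 < t by rewrite (le_lt_trans _ t0)// L2norm_ge0.
have : L2norm (T (d / t *: u) - T 0) < 1.
  apply: Td; rewrite subr0 L2normZ ger0_norm ?divr_ge0 ?ltW//.
  by rewrite mulrAC ltr_pdivrMr// ltr_pM2l.
rewrite (@L2norm_eq _ _ (d / t *: T u)) => [|w]; last first.
  by rewrite innerBl T0 subr0 homT.
rewrite L2normZ (ger0_norm (ltW (divr_gt0 d0 tgt0))) -tE => Tu1.
have -> : t / d = (d / t)^-1 * 1 by rewrite invf_div mulr1.
by apply: ltW; rewrite ltr_pdivlMl ?divr_gt0.
Qed.

Lemma linear_homeomorphism_bounded T : linear_homeomorphism T ->
  exists S C, [/\ L2_linear T, 0 < C, forall u, inner (T (S u)) =1 inner u,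
    forall u, L2norm (T u) <= C * L2norm u &
    forall u, L2norm (S u) <= C * L2norm u].
Proof.
move=> [S [linT cT cS ST TS]].
have TSi u : inner (T (S u)) =1 inner u by move=> w; exact: ae_eq_inner.
have homT a u : inner (T (a *: u)) =1 inner (a *: T u).
  move=> w; rewrite -[a *: u]addr0 L2_linear_inner// L2_linear0// addr0.
  by rewrite innerZl.
(* Homogeneity passes from [T] to its inverse: [S (a *: u)] agrees with [S (T (a *: S u))]. *)
have homS a u : inner (S (a *: u)) =1 inner (a *: S u).
  move=> w; rewrite -(ae_eq_inner w (ST (a *: S u))).
  by apply: L2_continuous_inner => // z; rewrite homT !innerZl TSi.
have [C C0 TC] := L2_bounded cT homT.
have [D D0 SD] := L2_bounded cS homS.
exists S, (C + D); split => //; first exact: addr_gt0.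
- by move=> u; rewrite (le_trans (TC u))// ler_wpM2r ?L2norm_ge0// lerDl ltW.
- by move=> u; rewrite (le_trans (SD u))// ler_wpM2r ?L2norm_ge0// lerDr ltW.
Qed.

(** * Bessel's inequality and Fourier expansion *)

Section Orthonormal.
Variable e : nat -> L2 R.
Hypothesis e_on : orthonormal_seq e.

Lemma inner_orthonormal_sum n (c : nat -> R) (j : 'I_n) :
  inner (\sum_(i < n) c i *: e i) (e j) = c j.
Proof.
rewrite inner_suml (bigD1 j)//= innerZl e_on eqxx mulr1.
rewrite big1 ?addr0// => i ij; rewrite innerZl e_on.
by rewrite (_ : (i == j :> nat) = false) ?mulr0//; apply/negbTE.
Qed.

Lemma sqr_L2norm_orthonormal_sum n (c : nat -> R) :
  L2norm (\sum_(i < n) c i *: e i) ^+ 2 = \sum_(i < n) c i ^+ 2.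
Proof.
rewrite sqr_L2norm [LHS]inner_sumr; apply: eq_bigr => j _.
by rewrite innerZr inner_orthonormal_sum expr2.
Qed.

(** Completing the square in each coefficient: the error is least at the Fourier coefficients. *)
Lemma sqr_L2norm_sub_orthonormal_sum u n (c : nat -> R) :
  L2norm (u - \sum_(i < n) c i *: e i) ^+ 2 =
  inner u u - \sum_(i < n) inner u (e i) ^+ 2
            + \sum_(i < n) (c i - inner u (e i)) ^+ 2.
Proof.
rewrite sqr_L2norm !(innerBl, innerBr) -[X in _ - (_ - X)]sqr_L2norm.
rewrite sqr_L2norm_orthonormal_sum (innerC _ u) inner_sumr.
under eq_bigr do rewrite innerZr.
have -> : \sum_(i < n) (c i - inner u (e i)) ^+ 2 = \sum_(i < n) c i ^+ 2 -
    2 * \sum_(i < n) c i * inner u (e i) + \sum_(i < n) inner u (e i) ^+ 2.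
  by rewrite mulr_sumr -sumrB -big_split; apply: eq_bigr => i _ /=; ring.
ring.
Qed.

Lemma bessel u n : \sum_(i < n) inner u (e i) ^+ 2 <= inner u u.
Proof.
have := sqr_L2norm_sub_orthonormal_sum u n (fun i => inner u (e i)).
rewrite [\sum_(i < n) (_ - _) ^+ 2]big1 ?addr0 => [E|i _]; last by rewrite subrr expr0n.
by rewrite -subr_ge0 -E sqr_ge0.
Qed.

(** Completeness supplies just some combination of one length [N]; Fourier coefficients do at least
    as well, and longer sums only lower the error. *)
Lemma orthonormal_expansion u : complete_seq e ->
  L2norm (u - \sum_(i < n) inner u (e i) *: e i) @[n --> \oo] --> (0 : R).
Proof.
move=> ce; apply/cvgrPdist_lt => eps eps0.
have [N [c]] := ce u _ eps0.
rewrite -ltr_sqr ?nnegrE ?L2norm_ge0 ?ltW// sqr_L2norm_sub_orthonormal_sum => uN.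
exists N => // n /= Nn.
rewrite sub0r normrN ger0_norm ?L2norm_ge0//.
rewrite -ltr_sqr ?nnegrE ?L2norm_ge0 ?ltW//.
rewrite (sqr_L2norm_sub_orthonormal_sum u n (fun i => inner u (e i))).
rewrite [\sum_(i < n) (_ - _) ^+ 2]big1 ?addr0 => [|i _]; last by rewrite subrr expr0n.
apply: le_lt_trans uN; apply: ler_wpDr.
  by apply: sumr_ge0 => i _; exact: sqr_ge0.
rewrite lerB// (big_ord_widen n (fun i => inner u (e i) ^+ 2) Nn).
rewrite [leRHS](bigID (fun i : 'I_n => (i < N)%N))/= lerDl.
by apply: sumr_ge0 => i _; exact: sqr_ge0.
Qed.

End Orthonormal.

(** [T] carries the Fourier expansion of [S v] to an expansion of [v] along [F]. The bounds then
    follow from Bessel for [S v] and Pythagoras before applying [T]. *)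
Lemma riesz_basis_expansion F psi : riesz_basis F -> biorthogonal F psi ->
  exists C, [/\ 0 < C,
    forall u v, \sum_(n < k) inner v (psi n) * inner (F n) u
      @[k --> \oo] --> inner v u,
    forall v k, \sum_(n < k) inner v (psi n) ^+ 2 <= (C * L2norm v) ^+ 2 &
    forall (c : nat -> R) k, L2norm (\sum_(n < k) c n *: F n) ^+ 2 <=
                             C ^+ 2 * \sum_(n < k) c n ^+ 2].
Proof.
move=> [e [T [e_on ce hT FT]]] bio.
have [S [C [linT C0 TS TC SC]]] := linear_homeomorphism_bounded hT.
have FTi n : inner (F n) =1 inner (T (e n)) by move=> w; exact: ae_eq_inner.
have expand u v : \sum_(n < k) inner (S v) (e n) * inner (F n) u
    @[k --> \oo] --> inner v u.
  pose r k := S v - \sum_(i < k) inner (S v) (e i) *: e i.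
  have rE k : inner v u - \sum_(n < k) inner (S v) (e n) * inner (F n) u =
      inner (T (r k)) u.
    have -> : r k = -1 *: (\sum_(i < k) inner (S v) (e i) *: e i) + S v.
      by rewrite scaleN1r addrC.
    rewrite (L2_linear_inner _ _ _ _ linT).
    rewrite (L2_linear_sum _ (fun i => inner (S v) (e i)) _ _ linT) TS mulN1r [RHS]addrC.
    by congr (_ - _); apply: eq_bigr => n _; rewrite FTi.
  apply/cvgrPdist_le => eps eps0.
  have := orthonormal_expansion e_on (S v) ce.
  (* The summand 1 keeps the denominator positive when [u] has norm 0. *)
  have d0 : 0 < eps / (C * (L2norm u + 1)).
    by rewrite divr_gt0// mulr_gt0// ltr_wpDl// L2norm_ge0.
  move=> /cvgrPdist_le /(_ _ d0); apply: filterS => k.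
  rewrite sub0r normrN (ger0_norm (L2norm_ge0 _)) -/(r k) => rk.
  rewrite rE (le_trans (Cauchy_Schwarz_L2 _ _))//.
  rewrite ler_pdivlMr in rk; last by rewrite mulr_gt0// ltr_wpDl// L2norm_ge0.
  apply: le_trans rk; rewrite mulrA (mulrC _ C).
  by rewrite ler_pM ?L2norm_ge0// lerDl.
(* Paired with [psi m], the expansion is constant from [m.+1] terms on, which reads off its
   coefficient. *)
have coef v m : inner v (psi m) = inner (S v) (e m).
  apply: (cvg_unique _ (expand (psi m) v)) => //.
  apply: cvg_near_cst; exists m.+1 => // k /= mk.
  rewrite (bigD1 (Ordinal mk))//= bio eqxx mulr1 big1 ?addr0// => i im.
  by rewrite bio (_ : (i == m :> nat) = false) ?mulr0//; exact/negbTE.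
exists C; split => // [u v|v k|c k].
- by under eq_fun do under eq_bigr do rewrite coef; exact: expand.
- under eq_bigr do rewrite coef.
  rewrite (le_trans (bessel e_on _ _))// -sqr_L2norm.
  by rewrite ler_sqr ?nnegrE ?mulr_ge0 ?L2norm_ge0// ltW.
rewrite -(sqr_L2norm_orthonormal_sum e_on) -exprMn.
rewrite ler_sqr ?nnegrE ?mulr_ge0 ?L2norm_ge0 ?(ltW C0)//.
rewrite (@L2norm_eq _ _ (T (\sum_(i < k) c i *: e i))) => [|w]; first exact: TC.
rewrite inner_suml (L2_linear_sum _ _ _ _ linT).
by apply: eq_bigr => i _; rewrite innerZl FTi.
Qed.

End RieszBasis.

(** The series starts at 1 and the partial sums at 0; the term [a 0%N ^+ 2] only shifts the
    bound. *)
Lemma summable_sqr_bounded (R : realType) (a : nat -> R) :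
  (\sum_(1 <= n <oo) (a n ^+ 2)%:E < +oo)%E <->
  exists M, forall k, \sum_(n < k) a n ^+ 2 <= M.
Proof.
have a2_ge0 n : (1 <= n)%N -> true -> (0 <= (a n ^+ 2)%:E)%E.
  by rewrite lee_fin sqr_ge0.
split => [aoo|[M aM]].
  exists (a 0%N ^+ 2 + fine (\sum_(1 <= n <oo) (a n ^+ 2)%:E)%E) => -[|k].
    rewrite big_ord0 addr_ge0 ?sqr_ge0// fine_ge0//.
    by apply: nneseries_ge0; exact: a2_ge0.
  rewrite -(big_mkord xpredT (fun n => a n ^+ 2)) big_ltn// lerD2l.
  rewrite -lee_fin fineK; last first.
    by rewrite ge0_fin_numE//; apply: nneseries_ge0; exact: a2_ge0.
  by rewrite -sumEFin; apply: nneseries_lim_ge; exact: a2_ge0.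
apply: (@le_lt_trans _ _ M%:E); last exact: ltry.
apply: lime_le; first by apply: is_cvg_nneseries; exact: a2_ge0.
apply: nearW => -[|k]; rewrite sumEFin lee_fin.
  by rewrite big_geq// (le_trans _ (aM 0%N))// big_ord0.
apply: le_trans (aM k.+1).
by rewrite -(big_mkord xpredT (fun n => a n ^+ 2)) [leRHS]big_ltn// lerDr sqr_ge0.
Qed.

Lemma sum_sqr_le_widen (R : realType) (a : nat -> R) m n : (m <= n)%N ->
  \sum_(i < m) a i ^+ 2 <= \sum_(i < n) a i ^+ 2.
Proof.
move=> mn; rewrite (big_ord_widen n (fun i => a i ^+ 2) mn).
rewrite [leRHS](bigID (fun i : 'I_n => (i < m)%N))/= lerDl.
by apply: sumr_ge0 => i _; exact: sqr_ge0.
Qed.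

(** * Convergence of the expansion of [g] along the biorthogonal system *)

Section BiorthogonalExpansion.
Context {R : realType}.
Variables (F psi : nat -> L2 R) (g : L2 R).
Hypotheses (hRiesz : riesz_basis F) (hpsi : biorthogonal F psi).

Let a n := inner (F n) g.
Let remd k := g - \sum_(n < k) a n *: psi n.

(** By duality, a partial sum of [g] along [psi] paired with [v] is a partial sum of [v] along [F]
    paired with [g]. *)
Lemma inner_biorthogonal_remainder k v :
  inner (remd k) v = inner v g - \sum_(n < k) inner v (psi n) * a n.
Proof.
rewrite innerBl inner_suml innerC; congr (_ - _); apply: eq_bigr => n _.
by rewrite innerZl mulrC innerC.
Qed.

Lemma weak_biorthogonal_expansion v : inner (remd k) v @[k --> \oo] --> (0 : R).
Proof.
have [C [_ expand _ _]] := riesz_basis_expansion hRiesz hpsi.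
rewrite (funext (inner_biorthogonal_remainder ^~ v)).
rewrite -[X in _ --> X](subrr (inner v g)).
by apply: cvgB; [exact: cvg_cst|exact: expand].
Qed.

Lemma strong_biorthogonal_expansion :
  L2norm (remd k) @[k --> \oo] --> (0 : R) <->
  exists M, forall k, \sum_(n < k) a n ^+ 2 <= M.
Proof.
have [C [C0 expand analysis synthesis]] := riesz_basis_expansion hRiesz hpsi.
pose A k := \sum_(n < k) a n ^+ 2.
split => [rem0|[M AM]].
  have [k0 _ remk] : \forall k \near \oo, L2norm (remd k) <= 1.
    move/cvgrPdist_le : rem0 => /(_ _ ltr01); apply: filterS => k.
    by rewrite sub0r normrN ger0_norm// L2norm_ge0.
  exists ((C * (L2norm g + 1)) ^+ 2) => k.
  (* Enlarging the index past [k0] only increases the sum and makes the remainder bound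
     available. *)
  apply: (@le_trans _ _ (A (maxn k0 k))); first exact/sum_sqr_le_widen/leq_maxr.
  (* Pairing [G] with [g - remd m] gives [A m], while the norm of [G] is at most [C] times the
     square root of [A m]. Cauchy-Schwarz then bounds [A m] after squaring and cancelling one
     factor. *)
  set m := maxn k0 k; pose G := \sum_(n < m) a n *: F n.
  have AG : A m = inner g G - inner (remd m) G.
    rewrite -innerBl /remd opprB addrC subrK inner_suml; apply: eq_bigr => n _.
    rewrite innerZl inner_sumr (bigD1 n)//= innerZr innerC hpsi eqxx mulr1.
    rewrite big1 ?addr0 ?expr2// => i ni.
    by rewrite innerZr innerC hpsi (_ : (i == n :> nat) = false) ?mulr0//; exact/negbTE.
  have Am0 : 0 <= A m by apply: sumr_ge0 => i _; exact: sqr_ge0.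
  have AB : A m <= (L2norm g + 1) * L2norm G.
    rewrite AG mulrDl mul1r lerD//.
      by rewrite (le_trans (ler_norm _))// Cauchy_Schwarz_L2.
    rewrite (le_trans (ler_norm _))// normrN (le_trans (Cauchy_Schwarz_L2 _ _))//.
    by rewrite ler_piMl ?L2norm_ge0// remk//= leq_maxl.
  have [->|An0] := eqVneq (A m) 0; first exact: sqr_ge0.
  rewrite -(@ler_pM2r _ (A m)) ?lt_def ?An0// -expr2 exprMn mulrAC -mulrA.
  rewrite (@le_trans _ _ (((L2norm g + 1) * L2norm G) ^+ 2))//.
    by rewrite ler_sqr// nnegrE (le_trans Am0).
  by rewrite exprMn mulrC mulrA ler_wpM2r ?sqr_ge0// synthesis.
have ndA : nondecreasing_seq A by move=> m n; exact: sum_sqr_le_widen.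
have cA : A @ \oo --> limn A.
  by apply: nondecreasing_is_cvgn => //; exists M => _ [k _ <-]; exact: AM.
(* Testing the remainder against itself and splitting the tail by AM-GM avoids
   completeness: [remd k] is controlled without extracting a limit of a Cauchy
   sequence. *)
have remA k : L2norm (remd k) ^+ 2 <= C ^+ 2 * (limn A - A k).
  pose d := remd k.
  pose p j := \sum_(n < j) inner d (psi n) * a n.
  have tail j : (k <= j)%N ->
      p j - p k <= L2norm d ^+ 2 / 2 + C ^+ 2 / 2 * (limn A - A k).
    move=> kj.
    (* The AM-GM weights are tuned so that, by [analysis], the first sum costs at most half of
       [L2norm d ^+ 2], which the closing [lra] absorbs. *)
    apply: (@le_trans _ _ ((\sum_(k <= n < j) inner d (psi n) ^+ 2) / (2 * C ^+ 2)
        + C ^+ 2 / 2 * (A j - A k))).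
      rewrite /p /A -!(big_mkord xpredT (fun n => inner d (psi n) * a n)).
      rewrite -!(big_mkord xpredT (fun n => a n ^+ 2)).
      rewrite !(big_cat_nat (leq0n k) kj)/= !(addrC (\sum_(0 <= i < k) _)) !addrK.
      rewrite mulr_suml mulr_sumr -big_split/=; apply: ler_sum => n _.
      rewrite -subr_ge0.
      set x := inner d (psi n); set y := a n.
      have -> : x ^+ 2 / (2 * C ^+ 2) + C ^+ 2 / 2 * y ^+ 2 - x * y =
          (x / C - C * y) ^+ 2 / 2 by field; rewrite gt_eqF.
      by rewrite divr_ge0// sqr_ge0.
    rewrite lerD//; last first.
      rewrite ler_wpM2l ?divr_ge0 ?sqr_ge0// lerB//.
      by apply: nondecreasing_cvgn_le => //; exact: cvgP cA.
    rewrite invfM mulrA mulrAC ler_pM2r ?invr_gt0//.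
    rewrite ler_pdivrMr ?exprn_gt0// -exprMn mulrC (le_trans _ (analysis d j))//.
    rewrite -(big_mkord xpredT (fun n => inner d (psi n) ^+ 2)).
    rewrite (big_cat_nat (leq0n k) kj)/= lerDr.
    by apply: sumr_ge0 => i _; exact: sqr_ge0.
  have : L2norm d ^+ 2 <= L2norm d ^+ 2 / 2 + C ^+ 2 / 2 * (limn A - A k).
    (* The squared norm of [d] is [inner d g - p k], the limit of [p j - p k] as [j] grows, so
       [tail] passes to the limit. *)
    rewrite {1}sqr_L2norm inner_biorthogonal_remainder -/(p k).
    have cp : p @ \oo --> inner d g := expand g d.
    rewrite -(cvg_lim _ cp)// lerBlDr; apply: limr_le; first exact: cvgP cp.
    by exists k => // j /= kj; rewrite -lerBlDr tail.
  lra.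
apply/cvgrPdist_le => eps eps0.
have d0 : 0 < (eps / C) ^+ 2 by rewrite exprn_gt0// divr_gt0.
move/cvgrPdist_le : cA => /(_ _ d0); apply: filterS => k Ak.
rewrite sub0r normrN ger0_norm ?L2norm_ge0//.
rewrite -ler_sqr ?nnegrE ?L2norm_ge0 ?(ltW eps0)// (le_trans (remA k))//.
have -> : eps ^+ 2 = C ^+ 2 * (eps / C) ^+ 2 by field; rewrite gt_eqF.
by rewrite ler_wpM2l ?sqr_ge0// (le_trans (ler_norm _)).
Qed.

End BiorthogonalExpansion.

(** The factor [inner phi0 phi0] is forced: each approximant pairs with [F 0%N] to this number,
    because [psi n] is orthogonal to [F 0%N] for positive [n]. *)
Theorem theorem5p2 (R : realType) (alpha beta : nat -> R) (F psi : nat -> L2 R)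
    (hF : fucik_system alpha beta F)
    (hRiesz : riesz_basis F)
    (hpsi : biorthogonal F psi) :
  weak_cvg
    (fun k => phi0 - \sum_(1 <= n < k.+1) inner (F n) phi0 *: psi n)
    (inner phi0 phi0 *: psi 0%N)
  /\
  (strong_cvg
     (fun k => phi0 - \sum_(1 <= n < k.+1) inner (F n) phi0 *: psi n)
     (inner phi0 phi0 *: psi 0%N)
   <->
   (\sum_(1 <= n <oo) ((inner (F n) phi0) ^+ 2)%:E < +oo)%E).
Proof.
have [_ _ F0 _] := hF.
set a := fun n => inner (F n) phi0.
(* As [F 0%N] is [phi0] almost everywhere, the proposed limit is exactly the missing term of index
   0. *)
have remE k : phi0 - \sum_(1 <= n < k.+1) a n *: psi n -
    inner phi0 phi0 *: psi 0%N = phi0 - \sum_(n < k.+1) a n *: psi n.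
  rewrite -(ae_eq_inner _ F0) -(big_mkord xpredT (fun n => a n *: psi n)).
  by rewrite big_ltn// opprD addrA addrAC.
split.
  move=> v; apply/subr_cvg0.
  rewrite (_ : (fun _ => _) =
      fun k => inner (phi0 - \sum_(n < k.+1) a n *: psi n) v).
    rewrite (cvg_shiftS (fun k => inner (phi0 - \sum_(n < k) a n *: psi n) v)).
    exact: weak_biorthogonal_expansion.
  by apply/funext => k /=; rewrite -innerBl remE.
rewrite summable_sqr_bounded -(strong_biorthogonal_expansion _ hRiesz hpsi).
rewrite /strong_cvg; rewrite (funext (fun k => congr1 L2norm (remE k))).
by rewrite (cvg_shiftS (fun k => L2norm (phi0 - \sum_(n < k) a n *: psi n))).
Qed.
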